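(* If $n=4$, then every embedding of $\mathcal{E}_1$ into $\mathbb{S}^n$ is congruent to one of $$\begin{pmatrix}v&w&x&0\\ w&y&0&0\\ x&0&0&0\\0&0&0&x\end{pmatrix},\qquad\begin{pmatrix}v&w&x&0\\ w&y&0&0\\ x&0&0&0\\0&0&0&y\end{pmatrix}.$$ If $n=5$, then every embedding of $\mathcal{E}_1$ into $\mathbb{S}^n$ is congruent to one of $$\begin{pmatrix}v&w&x&0&0\\ w&y&0&0&0\\ x&0&0&0&0\\0&0&0&x&0\\0&0&0&0&x\end{pmatrix},\qquad\begin{pmatrix}v&w&x&0&0\\ w&y&0&0&0\\ x&0&0&0&0\\0&0&0&x&0\\0&0&0&0&y\end{pmatrix},\qquad\begin{pmatrix}v&w&x&0&0\\ w&y&0&0&0\\ x&0&0&0&0\\0&0&0&y&0\\0&0&0&0&y\end{pmatrix}.$$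
   Context: $\mathbb{S}^n$ is the space of complex symmetric $n\times n$ matrices. For an invertible $U\in\mathbb{S}^n$, the product $X\bullet_U Y=\frac12(XU^{-1}Y+YU^{-1}X)$ makes $\mathbb{S}^n$ a unital Jordan algebra with unit $U$. An embedding of a unital Jordan algebra $\mathcal{A}$ into $\mathbb{S}^n$ is the image of an injective linear map $\mathcal{A}\to\mathbb{S}^n$ preserving products and units, where $\mathbb{S}^n$ carries $\bullet_U$ for some invertible $U\in\mathbb{S}^n$. Two subspaces $\mathcal{L},\mathcal{L}'\subseteq\mathbb{S}^n$ are congruent if $\mathcal{L}'=P\mathcal{L}P^\top$ for some $P\in\mathrm{GL}_n(\mathbb{C})$. $\mathcal{E}_1$ is the $4$-dimensional complex Jordan algebra with basis $X,Y,V,W$, unit $X+Y$, and commutative product given by $X^2=X$, $XY=0$, $XV=V$, $XW=\frac12W$, $Y^2=Y$, $YV=0$, $YW=\frac12W$, $V^2=0$, $VW=0$, $W^2=V$. A matrix whose entries are linear forms in the indeterminates $v,w,x,y$ denotes the linear space of all matrices obtained by substituting complex numbers for the indeterminates. *)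

(* Defs.v *)
From HB Require Import structures.
From mathcomp Require Import all_boot all_order all_algebra.
From mathcomp Require Import boolp classical_sets reals.
From mathcomp.real_closed Require Import complex.
From mathcomp Require Import ring.

Set Implicit Arguments.
Unset Strict Implicit.
Unset Printing Implicit Defensive.

Import Order.TTheory GRing.Theory Num.Theory.

Local Open Scope classical_set_scope.
Local Open Scope ring_scope.

Record unitalJordanAlgebra (F : fieldType) := UnitalJordanAlgebra {
  jcarrier :> vectType F;
  jmul : jcarrier -> jcarrier -> jcarrier;
  jone : jcarrier;
  jmul_linearl : forall b, linear (jmul ^~ b);
  jmulC : commutative jmul;
  jmul1 : left_id jone jmul;
  jordan_identity : forall a b,
    jmul (jmul a b) (jmul a a) = jmul a (jmul b (jmul a a))
}.

Section SymmetricMatrices.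
Variables (F : fieldType) (n : nat).
Implicit Types (L : set 'M[F]_n) (U X Y M P : 'M[F]_n).

Definition sym_jmul U X Y : 'M[F]_n :=
  2^-1 *: (X *m invmx U *m Y + Y *m invmx U *m X).

Definition is_embedding (A : unitalJordanAlgebra F) L : Prop :=
  exists (U : 'M[F]_n) (phi : {linear A -> 'M[F]_n}),
    [/\ U \is symmetricmx /\ U \in unitmx,
        (forall a, phi a \is symmetricmx) /\ injective phi,
        forall a b, phi (jmul a b) = sym_jmul U (phi a) (phi b),
        phi (jone A) = U
      & L = range phi].

Definition congruent L L' : Prop :=
  exists2 P : 'M[F]_n, P \in unitmx & L' = [set P *m M *m P^T | M in L].

Definition mx_of_rows (rows : seq (seq F)) : 'M[F]_n :=
  \matrix_(i, j) (nth [::] rows i)`_j.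

(* The space denoted by a matrix [rows v w x y] of linear forms. *)
Definition mx_space (rows : F -> F -> F -> F -> seq (seq F)) : set 'M[F]_n :=
  [set M | exists v w x y : F, M = mx_of_rows (rows v w x y)].

End SymmetricMatrices.

Arguments mx_space {F} n rows.

Section E1.
Variable F : numFieldType.

Definition E1_vec (x y v w : F) : 'rV[F]_4 := \row_j [:: x; y; v; w]`_j.

Definition E1_X : 'rV[F]_4 := E1_vec 1 0 0 0.
Definition E1_Y : 'rV[F]_4 := E1_vec 0 1 0 0.
Definition E1_V : 'rV[F]_4 := E1_vec 0 0 1 0.
Definition E1_W : 'rV[F]_4 := E1_vec 0 0 0 1.

(* The row vector (a0, a1, a2, a3) stands for a0 X + a1 Y + a2 V + a3 W, see
   [E1_decomp]; the product is the bilinear extension of the multiplication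
   table of this basis, see [E1_table]. *)
Definition E1_mul (a b : 'rV[F]_4) : 'rV[F]_4 :=
  let: (ax, ay, av, aw) := (a 0 0, a 0 1, a 0 2%:R, a 0 3%:R) in
  let: (bx, by_, bv, bw) := (b 0 0, b 0 1, b 0 2%:R, b 0 3%:R) in
  E1_vec (ax * bx)
         (ay * by_)
         (ax * bv + av * bx + aw * bw)
         (2^-1 * (ax * bw + aw * bx + ay * bw + aw * by_)).

Definition E1_one : 'rV[F]_4 := E1_X + E1_Y.

Lemma E1_eqP (a b : 'rV[F]_4) :
  a 0 0 = b 0 0 -> a 0 1 = b 0 1 -> a 0 2%:R = b 0 2%:R ->
  a 0 3%:R = b 0 3%:R -> a = b.
Proof.
move=> h0 h1 h2 h3; apply/rowP=> -[[|[|[|[|//]]]] lti].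
- by move: h0; congr (a 0 _ = b 0 _); apply: val_inj.
- by move: h1; congr (a 0 _ = b 0 _); apply: val_inj.
- by move: h2; congr (a 0 _ = b 0 _); apply: val_inj.
- by move: h3; congr (a 0 _ = b 0 _); apply: val_inj.
Qed.

Lemma E1_decomp (a : 'rV[F]_4) :
  a = a 0 0 *: E1_X + a 0 1 *: E1_Y + a 0 2%:R *: E1_V + a 0 3%:R *: E1_W.
Proof. by apply: E1_eqP; rewrite !mxE /=; ring. Qed.

Lemma E1_table :
  [/\ [/\ E1_mul E1_X E1_X = E1_X, E1_mul E1_X E1_Y = 0,
          E1_mul E1_X E1_V = E1_V & E1_mul E1_X E1_W = 2^-1 *: E1_W],
      [/\ E1_mul E1_Y E1_Y = E1_Y, E1_mul E1_Y E1_V = 0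
        & E1_mul E1_Y E1_W = 2^-1 *: E1_W],
      E1_mul E1_V E1_V = 0, E1_mul E1_V E1_W = 0
    & E1_mul E1_W E1_W = E1_V].
Proof. by do ?split; apply: E1_eqP; rewrite !mxE /=; ring. Qed.

Lemma E1_mul_linearl (b : 'rV[F]_4) : linear (E1_mul ^~ b).
Proof. by move=> k a a'; apply: E1_eqP; rewrite !mxE /=; ring. Qed.

Lemma E1_mulC : commutative E1_mul.
Proof. by move=> a b; apply: E1_eqP; rewrite !mxE /=; ring. Qed.

Lemma E1_mul1 : left_id E1_one E1_mul.
Proof. by move=> a; apply: E1_eqP; rewrite !mxE /=; field. Qed.

Lemma E1_jordan_identity a b :
  E1_mul (E1_mul a b) (E1_mul a a) = E1_mul a (E1_mul b (E1_mul a a)).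
Proof. by apply: E1_eqP; rewrite !mxE /=; field. Qed.

Definition E1 : unitalJordanAlgebra F :=
  UnitalJordanAlgebra E1_mul_linearl E1_mulC E1_mul1 E1_jordan_identity.

End E1.

(* Main.v *)
Require Import Defs.
From HB Require Import structures.
From mathcomp Require Import all_boot all_order all_algebra perm.
From mathcomp Require Import boolp classical_sets reals.
From mathcomp.real_closed Require Import complex.
From mathcomp Require Import ring.

Set Implicit Arguments.
Unset Strict Implicit.
Unset Printing Implicit Defensive.

Import Order.TTheory GRing.Theory Num.Theory.

Local Open Scope classical_set_scope.
Local Open Scope ring_scope.

(** An embedding of [E1] with unit [U] is studied through the operators
    [rho a = phi a * U^-1] acting on row vectors. They are self-adjoint for the
    symmetric bilinear form [U], and turn the product with unit [U] into the
    Jordan product [(rho a * rho b + rho b * rho a) / 2] with unit 1. Write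
    e, w, v for the operators of X, W, V. The multiplication table says that
    e is idempotent, that w exchanges the two eigenspaces of e, and that
    [w^2 = v] is nonzero, lives on the 1-eigenspace of e and satisfies
    [w^3 = 0] ([embedding_triple]).

    Choose g in the 1-eigenspace of e with [g v] not orthogonal to g. After
    a scaling, and after adding a multiple of [g v] to make g isotropic, the
    chain g, g w, g w^2 has the antidiagonal identity as Gram matrix
    ([triple_vector]); on it the forms [phi a] give the 3 x 3 block with
    entries v, w, x, y. The chain is stable under e and w, hence so is its
    orthogonal complement, which is nondegenerate of dimension [n - 3] and
    has an orthonormal basis of eigenvectors of e
    ([orthonormal_eigenvectors]). In that basis w becomes a symmetric
    nilpotent matrix N that exchanges the eigenspaces of e. In dimension at
    most 2 such an N vanishes ([nilpotent_symmetric]), so on the complement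
    [phi a] is diagonal, with entry x or y according to the eigenvalue of e.
    The normal form then depends only on how often each eigenvalue occurs,
    which gives [n - 2] cases. *)

(** * Matrix preliminaries *)

Lemma tr_symmetricmx (F : fieldType) (n : nat) (A : 'M[F]_n) :
  A \is symmetricmx -> A^T = A.
Proof.
by move/is_hermitianmxP; rewrite expr0 scale1r map_mx_id // => {2}->.
Qed.

Lemma mulmx_tr_entry (R : comNzRingType) (m n p : nat) (A : 'M[R]_(m, n))
    (M : 'M_n) (B : 'M_(p, n)) i j :
  (A *m M *m B^T) i j = (row i A *m M *m (row j B)^T) 0 0.
Proof.
rewrite tr_row -row_mul [LHS]mxE [RHS]mxE; apply: eq_bigr => k _.
by rewrite !mxE.
Qed.

Lemma double_inj (F : numFieldType) (n : nat) (M N : 'M[F]_n) :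
  M + M = N + N -> M = N.
Proof.
have two0 : 2 != 0 :> F by rewrite pnatr_eq0.
by rewrite -!mulr2n -!scaler_nat => /(scalerI two0).
Qed.

(** In the Jordan product of an associative algebra, an idempotent with
    eigenvalue 1 on v acts as the identity on v from the left alone: multiplying
    the hypothesis by e on either side gives [e v = e v e = v e]. *)
Lemma idempotent_absorbs (F : numFieldType) (n : nat) (e v : 'M[F]_n) :
  e *m e = e -> e *m v + v *m e = v + v -> e *m v = v.
Proof.
move=> ee ev2; have eve : e *m v *m e = e *m v.
  by apply: (addrI (e *m v)); rewrite -[RHS]mulmxDr -ev2 mulmxDr !mulmxA ee.
have vev : e *m v *m e = v *m e.
  by apply: (addIr (v *m e)); rewrite -[RHS]mulmxDl -ev2 mulmxDl -(mulmxA v) ee.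
by apply: double_inj; rewrite -ev2 -{1}eve vev addrC.
Qed.

(** * Unit vectors and orthonormal eigenvectors of a complex symmetric form *)

Section Forms.
Variables (F : numClosedFieldType) (n : nat).
Implicit Types U S Q e w : 'M[F]_n.

Lemma scale_to_unit (S : 'M[F]_n) (z : 'rV[F]_n) :
  z *m S *m z^T != 0 -> exists c : F, (c *: z) *m S *m (c *: z)^T = 1%:M.
Proof.
move=> nz; set q := (z *m S *m z^T) 0 0.
have qE : z *m S *m z^T = q%:M by rewrite [LHS]mx11_scalar.
have q0 : q != 0 by apply: contra nz => /eqP q0; rewrite qE q0 raddf0.
have s0 : sqrtC q != 0 by rewrite sqrtC_eq0.
exists (sqrtC q)^-1.
rewrite linearZ /= -!scalemxAl -scalemxAr qE !scale_scalar_mx.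
by rewrite -[X in _ * (_ * X)]sqrtCK expr2 mulKf // mulVf.
Qed.

(** By polarization a nonzero symmetric form has a nonisotropic vector, which a
    square root scales to norm 1. *)
Lemma symmetric_unit_vector (S : 'M[F]_n) :
  S^T = S -> S != 0 -> exists z : 'rV[F]_n, z *m S *m z^T = 1%:M.
Proof.
move=> symS nzS; suff [z nz] : exists z : 'rV[F]_n, z *m S *m z^T != 0.
  by have [c cE] := scale_to_unit nz; exists (c *: z).
apply: contrapT => noz; case/negP: nzS.
have zz (z : 'rV[F]_n) : z *m S *m z^T = 0.
  by apply/eqP; apply: contrapT => /negP nz; apply: noz; exists z.
have ent i j : S i j = (('e_i : 'rV_n) *m S *m ('e_j : 'rV_n)^T) 0 0.
  by rewrite trmx_delta -colE -rowE !mxE.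
apply/eqP/matrixP => i j; rewrite mxE.
have := congr1 (fun M : 'M_1 => M 0 0) (zz ('e_i + 'e_j)).
rewrite linearD /= !(mulmxDl, mulmxDr) !zz addr0 add0r mxE -!ent.
by rewrite -{2}symS !mxE => /eqP; rewrite -mulr2n mulrn_eq0 /= => /eqP.
Qed.

(** A unit vector z of the symmetric form [Q U] projects to [h = z Q], and
    [h U h^T = z Q U z^T] since Q is a self-adjoint idempotent. *)
Lemma idempotent_unit_vector (U Q : 'M[F]_n) :
  U^T = U -> U \in unitmx -> Q *m Q = Q -> (Q *m U)^T = Q *m U -> Q != 0 ->
  exists h : 'rV[F]_n, h *m Q = h /\ h *m U *m h^T = 1%:M.
Proof.
move=> symU unitU QQ symQU nzQ.
have nzQU : Q *m U != 0.
  by apply: contra nzQ => /eqP QU0; rewrite -[Q](mulmxK unitU) QU0 mul0mx.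
have [z zE] := symmetric_unit_vector symQU nzQU.
exists (z *m Q); rewrite -mulmxA QQ; split=> //.
have QUT : U *m Q^T = Q *m U by rewrite -symQU trmx_mul symU.
by rewrite trmx_mul mulmxA -(mulmxA _ U) QUT !mulmxA -(mulmxA z) QQ -zE mulmxA.
Qed.

(** The orthogonal projection p onto the complement of the rows of T is nonzero
    for reasons of rank and commutes with e, because e stabilizes these rows. So
    [p e] and [p (1 - e)] are self-adjoint idempotents, not both zero. *)
Lemma orthogonal_eigenvector (k : nat) (U e : 'M[F]_n) (T : 'M[F]_(k, n))
    (D : 'M[F]_k) :
  (k < n)%N -> U^T = U -> U \in unitmx ->
  e *m e = e -> (e *m U)^T = e *m U ->
  T *m U *m T^T \in unitmx -> T *m e = D *m T ->
  exists (h : 'rV[F]_n) (b : bool),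
    [/\ h *m U *m T^T = 0, h *m U *m h^T = 1%:M & h *m e = b%:R *: h].
Proof.
move=> ltkn symU unitU ee symeU; set G := T *m U *m T^T => unitG Te.
have UeT : U *m e^T = e *m U by rewrite -symeU trmx_mul symU.
have symG : G^T = G by rewrite /G !trmx_mul trmxK symU mulmxA.
have GD : G *m D^T = D *m G.
  rewrite /G -mulmxA -trmx_mul -Te trmx_mul !mulmxA.
  by rewrite -(mulmxA T U) UeT !mulmxA Te.
have iGD : D^T *m invmx G = invmx G *m D.
  by apply: (canRL (mulKmx unitG)); rewrite mulmxA GD mulmxK.
pose A := U *m T^T *m invmx G *m T.
pose p : 'M[F]_n := 1%:M - A.
have pUT : p *m U *m T^T = 0.
  rewrite /p !mulmxBl !mul1mx /A -!mulmxA (mulmxA T) -/G mulVmx // mulmx1.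
  by rewrite subrr.
have Ap : p *m A = 0 by rewrite /A !mulmxA pUT !mul0mx.
have pp : p *m p = p by rewrite {2}/p mulmxBr mulmx1 Ap subr0.
have pe : p *m e = e *m p.
  rewrite /p mulmxBl mulmxBr mul1mx mulmx1; congr (_ - _); rewrite /A.
  rewrite -!mulmxA Te !mulmxA -UeT -!mulmxA (mulmxA e^T) -trmx_mul Te trmx_mul.
  by rewrite -!mulmxA (mulmxA (D^T)) iGD !mulmxA.
have pU : (p *m U)^T = p *m U.
  rewrite /p mulmxBl mul1mx linearB /= symU; congr (_ - _).
  by rewrite /A !trmx_mul !trmxK trmx_inv symG symU !mulmxA.
have p0 : p != 0.
  apply/eqP => p0; have A1 : A = 1%:M.
    by apply/esym/eqP; rewrite -subr_eq0 -/p p0.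
  have := mxrankM_maxr (U *m T^T *m invmx G) T.
  rewrite -/A A1 mxrank1 => /leq_trans/(_ (rank_leq_row T)).
  by rewrite leqNgt ltkn.
have eigen (f : 'M[F]_n) (b : bool) : f *m f = f -> (f *m U)^T = f *m U ->
    p *m f = f *m p -> f *m e = b%:R *: f -> p *m f != 0 ->
  exists (h : 'rV[F]_n) (b : bool),
    [/\ h *m U *m T^T = 0, h *m U *m h^T = 1%:M & h *m e = b%:R *: h].
  move=> ff fU pf fe pf0.
  have [||h [hpf hh]] := idempotent_unit_vector symU unitU _ _ pf0.
  - by rewrite {2}pf mulmxA -(mulmxA p) ff -mulmxA -pf mulmxA pp.
  - by rewrite -mulmxA trmx_mul fU -mulmxA -{1}symU -trmx_mul pU !mulmxA pf.
  exists h, b; split=> //.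
    by rewrite -hpf pf -!mulmxA (mulmxA p) pUT !mulmx0.
  by rewrite -{1}hpf -!mulmxA fe -!scalemxAr hpf.
have [pe0|] := eqVneq (p *m e) 0; last first.
  by apply: (eigen _ true) => //; rewrite scale1r.
apply: (eigen (1%:M - e) false).
- by rewrite mulmxBr mulmx1 mulmxBl mul1mx ee subrr subr0.
- by rewrite mulmxBl mul1mx linearB /= symU symeU.
- by rewrite [LHS]mulmxBr [RHS]mulmxBl mulmx1 mul1mx pe.
- by rewrite mulmxBl mul1mx ee subrr scale0r.
- by rewrite mulmxBr pe0 subr0 mulmx1.
Qed.

(** Each eigenvector found joins T, which stays stable under e and
    nondegenerate. *)
Lemma orthonormal_eigenvectors (k m : nat) (U e : 'M[F]_n) (T : 'M[F]_(k, n))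
    (D : 'M[F]_k) :
  (k + m <= n)%N -> U^T = U -> U \in unitmx ->
  e *m e = e -> (e *m U)^T = e *m U ->
  T *m U *m T^T \in unitmx -> T *m e = D *m T ->
  exists (H : 'M[F]_(m, n)) (d : 'I_m -> bool),
    [/\ H *m U *m T^T = 0, H *m U *m H^T = 1%:M
      & forall i, row i H *m e = (d i)%:R *: row i H].
Proof.
move=> lekmn symU unitU ee symeU unitG Te.
elim: m lekmn => [|m IHm] lekmn.
  exists 0, (fun=> false).
  by split; [rewrite !mul0mx | apply/matrixP => -[] | case].
have [|H [d [HT HH He]]] := IHm.
  by rewrite (leq_trans _ lekmn) // leq_add2l.
pose Dd : 'M[F]_m := diag_mx (\row_i (d i)%:R).
have HeD : H *m e = Dd *m H.
  apply/row_matrixP => i; rewrite row_mul He /Dd mul_diag_mx.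
  by apply/rowP => j; rewrite !mxE.
have TH : T *m U *m H^T = 0.
  by apply: trmx_inj; rewrite !trmx_mul trmxK symU mulmxA HT trmx0.
have gramTH : col_mx T H *m U *m (col_mx T H)^T \in unitmx.
  rewrite tr_col_mx mul_col_mx mul_col_row TH HT HH.
  by rewrite unitmxE det_ublock det1 mulr1 -unitmxE.
have THe : col_mx T H *m e = block_mx D 0 0 Dd *m col_mx T H.
  by rewrite mul_col_mx Te HeD mul_block_col !mul0mx addr0 add0r.
have ltkm : (k + m < n)%N by rewrite -addnS.
have [h [b [hTH hh he]]] :=
  orthogonal_eigenvector ltkm symU unitU ee symeU gramTH THe.
move: hTH; rewrite tr_col_mx mul_mx_row -row_mx0 => /eq_row_mx [hT hH].
have Hh : H *m U *m h^T = 0.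
  by apply: trmx_inj; rewrite !trmx_mul trmxK symU mulmxA hH trmx0.
rewrite -[m.+1]/(1 + m)%N.
exists (col_mx h H),
  (fun i => match split i with inl _ => b | inr j => d j end).
split.
- by rewrite !mul_col_mx hT HT col_mx0.
- rewrite tr_col_mx mul_col_mx mul_col_row hh hH Hh HH.
  by rewrite -scalar_mx_block.
move=> i; case: (split_ordP i) => j ->.
  by rewrite rowKu row_id.
by rewrite rowKd.
Qed.

End Forms.

(** * The operators of an embedding *)

Section Triples.
Variable F : numClosedFieldType.

Lemma self_adjointX (n : nat) (U w : 'M[F]_n) k :
  U^T = U -> (w *m U)^T = w *m U -> U *m (w ^+ k)^T = w ^+ k *m U.
Proof.
move=> symU symwU; elim: k => [|k IHk].
  by rewrite !expr0 trmx1 mulmx1 mul1mx.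
rewrite {1}exprS -mulmxE trmx_mul mulmxA IHk -mulmxA -{1}symU -trmx_mul symwU.
by rewrite mulmxA exprSr.
Qed.

(** The relations between the operators e, w of the elements X, W of [E1]; the
    operators of V and Y are [w^2] and [1 - e]. *)
Record E1_triple (n : nat) (U e w : 'M[F]_n) : Prop := E1Triple {
  triple_symU : U^T = U;
  triple_unitU : U \in unitmx;
  triple_syme : (e *m U)^T = e *m U;
  triple_symw : (w *m U)^T = w *m U;
  triple_ee : e *m e = e;
  triple_ew : e *m w + w *m e = w;
  triple_ew2 : e *m (w *m w) = w *m w;
  triple_w3 : w ^+ 3 = 0;
  triple_w2 : w *m w != 0
}.

Lemma triple_w2e (n : nat) (U e w : 'M[F]_n) :
  E1_triple U e w -> w *m w *m e = w *m w.
Proof.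
case=> symU unitU symeU symwU _ _ ew2 _ _; apply: (can_inj (mulmxK unitU)).
have Uw2 : U *m (w *m w)^T = w *m w *m U by exact: (self_adjointX 2 symU symwU).
rewrite -(mulmxA _ e U) -symeU trmx_mul symU mulmxA -{1}Uw2.
by rewrite -mulmxA -trmx_mul ew2 Uw2.
Qed.

(** For g fixed by e, the vector [g w] lies in the other eigenspace of e,
    hence is orthogonal to g, and [g w^k = 0] for k > 2. So only k = 0 and
    k = 2 impose conditions on g. *)
Lemma triple_vector (n : nat) (U e w : 'M[F]_n) :
  E1_triple U e w ->
  exists g : 'rV[F]_n, g *m e = g /\
    forall k, g *m w ^+ k *m U *m g^T = (k == 2)%:R%:M.
Proof.
move=> tr; have [symU unitU symeU symwU ee ew ew2 w3 w2] := tr.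
have Ue : U *m e^T = e *m U by rewrite -{1}symU -trmx_mul.
have Uw2 : U *m (w ^+ 2)^T = w ^+ 2 *m U by exact: self_adjointX.
have [v vE] : exists v, w ^+ 2 = v by exists (w ^+ 2).
have wwE : w *m w = v by rewrite -vE expr2 mulmxE.
rewrite vE in Uw2; rewrite wwE in ew2 w2.
have ve : v *m e = v by rewrite -wwE (triple_w2e tr).
have [||z zE] := @symmetric_unit_vector F n (v *m U).
- by rewrite trmx_mul symU Uw2.
- by apply: contra w2 => /eqP v0; rewrite -[v](mulmxK unitU) v0 mul0mx.
rewrite mulmxA in zE; pose f := z *m e.
have fe : f *m e = f by rewrite /f -mulmxA ee.
have fw2 : f *m v *m U *m f^T = 1%:M.
  rewrite /f trmx_mul -(mulmxA z) ew2 !mulmxA -(mulmxA _ U) Ue mulmxA.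
  by rewrite -(mulmxA z) ve zE.
have wbig k : (2 < k)%N -> w ^+ k = 0.
  by move=> k2; rewrite -(subnKC k2) exprD w3 mul0r.
(* Adding c times f v changes the norm of f by 2 c, since f v is isotropic and
   has product 1 with f. *)
clearbody f; pose q := (f *m U *m f^T) 0 0.
have qE : f *m U *m f^T = q%:M by rewrite [LHS]mx11_scalar.
pose g := f - (q / 2) *: (f *m v).
have ge : g *m e = g by rewrite /g mulmxBl -scalemxAl -(mulmxA f v) ve fe.
have gw k : (0 < k)%N -> g *m w ^+ k = f *m w ^+ k.
  move=> k0; rewrite /g mulmxBl -scalemxAl -(mulmxA f v) -vE mulmxE -exprD.
  by rewrite (@wbig (2 + k)%N) ?mulmx0 ?scaler0 ?subr0.
have gv : g *m v = f *m v by rewrite -vE gw.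
have gT : g^T = f^T - (q / 2) *: (v^T *m f^T).
  by rewrite /g linearB linearZ /= trmx_mul.
have UgT : U *m g^T = U *m f^T - (q / 2) *: (v *m U *m f^T).
  by rewrite gT mulmxBr -scalemxAr mulmxA Uw2.
have gg : g *m U *m g^T = 0.
  rewrite -mulmxA UgT mulmxBr -scalemxAr !mulmxA gv fw2.
  rewrite {1}/g !mulmxBl -!scalemxAl fw2 qE.
  by apply/matrixP => i j; rewrite !ord1 !mxE eqxx /=; field.
clearbody g; exists g; split=> // -[|[|[|k]]].
- by rewrite expr0 mulmx1 gg raddf0.
(* Substituting e w + w e for w shows that this product is twice itself. *)
- have odd0 : g *m w *m U *m g^T = g *m (e *m w + w *m e) *m U *m g^T.
    by rewrite ew.
  apply/eqP; rewrite expr1 raddf0 -(inj_eq (addrI (g *m w *m U *m g^T))) addr0.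
  rewrite [X in _ == X]odd0 mulmxDr !mulmxDl !mulmxA ge -(mulmxA _ e) -Ue.
  by rewrite !mulmxA -(mulmxA _ (e^T)) -trmx_mul ge.
- rewrite vE gv -mulmxA UgT mulmxBr -scalemxAr !mulmxA fw2 -(mulmxA f) -vE.
  by rewrite mulmxE -exprD wbig // mulmx0 !mul0mx scaler0 subr0.
- by rewrite wbig // mulmx0 !mul0mx raddf0.
Qed.

(** The relation [w^3 = 0] holds because [w^3] equals both v w and w v, whose
    sum is the operator of [2 V W = 0]. *)
Lemma embedding_triple (n : nat) (U : 'M[F]_n)
    (phi : {linear E1 F -> 'M[F]_n}) :
  U \is symmetricmx -> U \in unitmx -> (forall a, phi a \is symmetricmx) ->
  injective phi -> (forall a b, phi (jmul a b) = sym_jmul U (phi a) (phi b)) ->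
  let rho a := phi a *m invmx U in
  E1_triple U (rho (E1_X F)) (rho (E1_W F)) /\
  rho (E1_W F) *m rho (E1_W F) = rho (E1_V F).
Proof.
move=> symU unitU symphi injphi mulphi rho.
have rhoU a : rho a *m U = phi a by rewrite /rho mulmxKV.
have rhoZ c a : rho (c *: a) = c *: rho a by rewrite /rho linearZ /= scalemxAl.
have rho0 : rho 0 = 0 by rewrite /rho linear0 mul0mx.
have two0 : 2 != 0 :> F by rewrite pnatr_eq0.
have rhoM a b : rho a *m rho b + rho b *m rho a = 2 *: rho (jmul a b).
  rewrite /rho mulphi /sym_jmul -scalemxAl scalerA divff // scale1r mulmxDl.
  by rewrite !mulmxA.
have [[XX _ XV XW] _ _ VW WW] := E1_table F.
set e := rho (E1_X F); set w := rho (E1_W F); set v := rho (E1_V F).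
have ee : e *m e = e by apply: double_inj; rewrite rhoM [jmul _ _]XX scaler_nat.
have ew : e *m w + w *m e = w.
  by rewrite rhoM [jmul _ _]XW rhoZ scalerA divff // scale1r.
have ww : w *m w = v by apply: double_inj; rewrite rhoM [jmul _ _]WW scaler_nat.
have ev2 : e *m v + v *m e = v + v by rewrite rhoM [jmul _ _]XV scaler_nat.
have ev : e *m v = v := idempotent_absorbs ee ev2.
have w3 : w ^+ 3 = 0.
  have w3E : w ^+ 3 = w *m v by rewrite -ww.
  have w3E' : w ^+ 3 = v *m w by rewrite -ww -mulmxA.
  apply: double_inj.
  by rewrite {1}w3E' w3E rhoM [jmul _ _]VW rho0 scaler0 addr0.
split=> //; split; rewrite ?rhoU ?tr_symmetricmx ?ww //.
apply/eqP => v0; have /injphi/rowP/(_ 2%:R) : phi (E1_V F) = phi 0.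
  by rewrite -rhoU -/v v0 mul0mx linear0.
by rewrite !mxE /= => /eqP; rewrite oner_eq0.
Qed.

End Triples.

(** * The chain and its orthogonal complement *)

Section NormalForm.
Variable F : numClosedFieldType.

Definition chain (n : nat) (w : 'M[F]_n) (g : 'rV[F]_n) : 'M[F]_(3, n) :=
  \matrix_(i < 3) (g *m w ^+ i).

Lemma chain_entry (k n : nat) (U e w : 'M[F]_n) (g : 'rV[F]_n)
    (A : 'M[F]_(k, n)) i j :
  E1_triple U e w ->
  (A *m U *m (chain w g)^T) i j = (row i A *m w ^+ j *m U *m g^T) 0 0.
Proof.
case=> symU _ _ symw _ _ _ _ _; rewrite mulmx_tr_entry rowK trmx_mul !mulmxA.
by rewrite -(mulmxA (row i A) U) self_adjointX // mulmxA.
Qed.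

(** The chain is stable under the self-adjoint operator w. *)
Lemma chain_orthogonal (n k : nat) (U e w : 'M[F]_n) (g : 'rV[F]_n)
    (A : 'M[F]_(k, n)) :
  E1_triple U e w -> A *m U *m (chain w g)^T = 0 ->
  A *m w *m U *m (chain w g)^T = 0.
Proof.
move=> tr AT; apply/matrixP => i j; rewrite (chain_entry _ _ _ _ tr) row_mul.
rewrite -(mulmxA _ w) mulmxE -exprS.
have [j2|j2] := ltnP j.+1 3.
  by rewrite -[j.+1]/(val (Ordinal j2)) -(chain_entry _ _ _ _ tr) AT !mxE.
have -> : j.+1 = 3 by apply/eqP; rewrite eqn_leq j2 ltn_ord.
by rewrite (triple_w3 tr) mulmx0 !mul0mx !mxE.
Qed.

Lemma chain_gram (n : nat) (U e w : 'M[F]_n) (g : 'rV[F]_n) k :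
  E1_triple U e w -> (forall l, g *m w ^+ l *m U *m g^T = (l == 2)%:R%:M) ->
  chain w g *m w ^+ k *m U *m (chain w g)^T
    = \matrix_(i, j) (i + j + k == 2)%N%:R.
Proof.
move=> tr gg; apply/matrixP => i j.
rewrite (chain_entry _ _ _ _ tr) row_mul rowK -!(mulmxA g) mulmxE.
rewrite -!exprD -mulmxE mulmxA mulmxA gg !mxE eqxx mulr1n.
by rewrite addnAC.
Qed.

Lemma chain_eigen (n : nat) (U e w : 'M[F]_n) (g : 'rV[F]_n) :
  E1_triple U e w -> g *m e = g ->
  chain w g *m e = diag_mx (\row_i (~~ odd i)%:R) *m chain w g.
Proof.
move=> tr ge; have [_ _ _ _ _ ew _ _ _] := tr.
apply/row_matrixP => i; rewrite row_mul rowK.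
have -> : row i (diag_mx (\row_i (~~ odd i)%:R) *m chain w g)
          = (~~ odd i)%:R *: (g *m w ^+ i).
  rewrite -[in RHS](rowK (fun i : 'I_3 => g *m w ^+ i)) -/(chain w g).
  by rewrite mul_diag_mx; apply/rowP => j; rewrite !mxE.
case: i => [[|[|[|//]]]] ?; rewrite /= ?scale1r ?scale0r.
- by rewrite expr0 mulmx1.
- rewrite expr1; have /(congr1 (mulmx g)) := ew.
  rewrite mulmxDr !mulmxA ge => /eqP; rewrite -subr_eq0 addrC addKr.
  by move/eqP.
- by rewrite expr2 -mulmxA -mulmxE (triple_w2e tr).
Qed.

(** The last hypothesis says that N exchanges the eigenspaces of the diagonal
    projection d. It makes the diagonal of N zero, so for m = 2 the matrix is
    [c] times the exchange matrix, whose cube is [c^3] times the exchange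
    matrix. The conclusion fails for m = 3: with d = (1, 1, 0) take the rows
    (0, 0, 1), (0, 0, i), (1, i, 0). *)
Lemma nilpotent_symmetric (m : nat) (N : 'M[F]_m) (d : 'I_m -> bool) :
  (m <= 2)%N -> N^T = N -> N *m N *m N = 0 ->
  (forall i j, ((d i)%:R + (d j)%:R) * N i j = N i j) -> N = 0.
Proof.
move=> m2 symN N3 dN.
have diag i : N i i = 0.
  move: (dN i i); case: (d i) => /=; last by rewrite addr0 mul0r.
  by rewrite mulrDl mul1r => /eqP; rewrite -subr_eq0 addrK => /eqP.
move: N d symN N3 dN diag.
case: m m2 => [|[|[|//]]] _ N d symN N3 dN diag.
- by apply/matrixP => -[].
- by apply/matrixP => i j; rewrite !ord1 diag mxE.
have N10 : N 1 0 = N 0 1 by rewrite -{1}symN mxE.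
have c0 : N 0 1 = 0.
  have := congr1 (fun M : 'M_2 => M 0 1) N3.
  rewrite !mxE !big_ord_recl !big_ord0 !mxE !big_ord_recl !big_ord0 /=.
  rewrite [lift _ _](_ : _ = 1); last exact: val_inj.
  rewrite !diag N10 !(mulr0, mul0r, addr0, add0r) => /eqP.
  by rewrite !mulf_eq0 !orbb => /eqP.
apply/matrixP => i j; rewrite [RHS]mxE.
case: i => [[|[|//]]] ?; case: j => [[|[|//]]] ?;
 rewrite -?[RHS](diag 0) -?[RHS](diag 1) -?[RHS]c0.
- by congr (N _ _); apply: val_inj.
- by rewrite diag -c0; congr (N _ _); apply: val_inj.
- by rewrite diag -c0 -N10; congr (N _ _); apply: val_inj.
- by rewrite diag -(diag 1); congr (N _ _); apply: val_inj.
Qed.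

(** The rows of T and H form a basis. Since w maps the complement of T into
    itself, it acts on the orthonormal rows of H by the matrix
    [N = H w U H^T], to which [nilpotent_symmetric] applies. *)
Lemma complement_w (m : nat) (U e w : 'M[F]_(3 + m)) (T : 'M[F]_(3, 3 + m))
    (H : 'M[F]_(m, 3 + m)) (d : 'I_m -> bool) :
  (m <= 2)%N -> E1_triple U e w -> T *m U *m T^T \in unitmx ->
  H *m U *m T^T = 0 -> H *m U *m H^T = 1%:M -> H *m w *m U *m T^T = 0 ->
  (forall i, row i H *m e = (d i)%:R *: row i H) ->
  col_mx T H \in unitmx /\ H *m w = 0.
Proof.
move=> m2 tr unitG HT HH HwT He.
have [symU unitU symeU symwU _ ew _ w3 _] := tr.
set P := col_mx T H.
have TH : T *m U *m H^T = 0.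
  by apply: trmx_inj; rewrite !trmx_mul trmxK symU mulmxA HT trmx0.
have unitP : P \in unitmx.
  have : P *m U *m P^T \in unitmx.
    rewrite tr_col_mx mul_col_mx mul_col_row TH HT HH unitmxE det_ublock det1.
    by rewrite mulr1 -unitmxE.
  by rewrite !unitmx_mul => /andP[/andP[]].
split=> //.
have [N NE] : exists N, N = H *m w *m U *m H^T.
  by exists (H *m w *m U *m H^T).
have HwN : H *m w = N *m H.
  have unitUP : U *m P^T \in unitmx by rewrite unitmx_mul unitU unitmx_tr.
  apply: (can_inj (mulmxK unitUP)).
  rewrite !mulmxA tr_col_mx !mul_mx_row HwT -!(mulmxA N) HT HH.
  by rewrite mulmx0 mulmx1 NE.
have rowN M i j :
    (H *m M *m U *m H^T) i j = (row i H *m M *m U *m (row j H)^T) 0 0.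
  by rewrite -(mulmxA H) mulmx_tr_entry mulmxA.
rewrite HwN (nilpotent_symmetric m2 (N := N) (d := d)) ?mul0mx //.
- by rewrite NE -(mulmxA H w U) !trmx_mul trmxK -trmx_mul symwU !mulmxA.
- suff N3H : N *m N *m N *m H = 0.
    by rewrite -[LHS]mulmx1 -HH !mulmxA N3H !mul0mx.
  rewrite -mulmxA -HwN mulmxA -(mulmxA N) -HwN !mulmxA -HwN -!(mulmxA H).
  by rewrite -mulmxA -[w *m (w *m w)]/(w ^+ 3) w3 mulmx0.
move=> i j; rewrite mulrDl NE -[in RHS]ew rowN [in RHS]rowN.
rewrite mulmxDr !mulmxDl [RHS]mxE !mulmxA He; congr (_ + _).
  by rewrite -!scalemxAl [RHS]mxE.
rewrite -(mulmxA _ e) -symeU trmx_mul symU mulmxA -(mulmxA _ e^T) -trmx_mul He.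
by rewrite linearZ /= -scalemxAr [RHS]mxE.
Qed.

(** * Normal forms of embeddings *)

Definition E1_block (v w x y : F) : 'M[F]_3 :=
  mx_of_rows 3 [:: [:: v; w; x]; [:: w; y; 0]; [:: x; 0; 0]].

Definition E1_space_mx (m : nat) (d : 'I_m -> bool) (v w x y : F) :
    'M[F]_(3 + m) :=
  block_mx (E1_block v w x y) 0 0 (diag_mx (\row_i (if d i then x else y))).

(** The coefficients a, b, x, y are those of V, W, X, Y. The permutation s
    reorders the orthonormal eigenvectors of the complement. *)
Lemma triple_normal_form (m : nat) (U e w : 'M[F]_(3 + m)) :
  (m <= 2)%N -> E1_triple U e w ->
  exists d : 'I_m -> bool, forall s : 'S_m, exists2 P, P \in unitmx &
    forall a b x y : F,
      P *m ((x *: e + y *: (1%:M - e) + a *: (w *m w) + b *: w) *m U) *m P^T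
      = E1_space_mx (d \o s) a b x y.
Proof.
move=> m2 tr; have [symU unitU symeU symwU ee _ _ _ _] := tr.
have [g [ge gg]] := triple_vector tr.
pose T := chain w g.
have Te : T *m e = diag_mx (\row_i (~~ odd i)%:R) *m T := chain_eigen tr ge.
have Tk k := chain_gram k tr gg.
have TUT : T *m U *m T^T = \matrix_(i, j) (i + j == 2)%N%:R.
  have := Tk 0%N; rewrite expr0 mulmx1 -/T => ->.
  by apply/matrixP => i j; rewrite !mxE addn0.
have unitG : T *m U *m T^T \in unitmx.
  suff GG : T *m U *m T^T *m (T *m U *m T^T) = 1%:M.
    by case: (mulmx1_unit GG).
  rewrite TUT; apply/matrixP => i j; rewrite !mxE !big_ord_recl big_ord0 !mxE.
  case: i => [[|[|[|//]]]] ?; case: j => [[|[|[|//]]]] ?;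
    by rewrite /= ?(mulr0, mul0r, mulr1, addr0, add0r).
have [H [d [HT HH He]]] :=
  orthonormal_eigenvectors (leqnn (3 + m)) symU unitU ee symeU unitG Te.
exists d => s; pose K := row_perm s H.
have KT : K *m U *m T^T = 0.
  by rewrite /K row_permE -!mulmxA (mulmxA H) HT mulmx0.
have KK : K *m U *m K^T = 1%:M.
  rewrite /K row_permE trmx_mul !mulmxA -!(mulmxA (perm_mx s)) HH mul1mx.
  by rewrite tr_perm_mx -perm_mxM mulgV perm_mx1.
have Ke i : row i K *m e = (d (s i))%:R *: row i K.
  have -> : row i K = row (s i) H by apply/rowP => j; rewrite !mxE.
  exact: He.
have KwT := chain_orthogonal tr KT.
have [unitP Kw] := complement_w m2 tr unitG KT KK KwT Ke.
exists (col_mx T K) => // a b x y.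
set M := _ + b *: w.
have KM : K *m M = diag_mx (\row_i (if d (s i) then x else y)) *m K.
  rewrite /M !mulmxDr -!scalemxAr mulmxA Kw mul0mx !scaler0 !addr0.
  apply/row_matrixP => i.
  have -> : row i (diag_mx (\row_i (if d (s i) then x else y)) *m K)
    = (if d (s i) then x else y) *: row i K.
    by rewrite mul_diag_mx; apply/rowP => j; rewrite !mxE.
  rewrite linearD /= !linearZ /= mulmxBr mulmx1 linearB /= row_mul Ke.
  case: (d (s i)); rewrite ?scale1r ?scale0r ?subrr ?subr0 ?scaler0;
    by rewrite ?addr0 ?add0r.
have KMT : K *m M *m U *m T^T = 0 by rewrite KM -!mulmxA (mulmxA K) KT mulmx0.
have MU : (M *m U)^T = M *m U.
  have symw2 : (w *m w *m U)^T = w *m w *m U.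
    by rewrite trmx_mul symU; exact: (self_adjointX 2 symU symwU).
  rewrite /M !mulmxDl -!scalemxAl mulmxBl mul1mx !linearD /= !linearZ /=.
  by rewrite linearN /= symw2 symeU symwU symU.
have TMK : T *m M *m U *m K^T = 0.
  apply: trmx_inj; rewrite trmx_mul trmxK -(mulmxA T M U) trmx_mul MU.
  by rewrite !mulmxA KMT trmx0.
rewrite tr_col_mx mul_col_mx mul_col_row !mulmxA KMT TMK KM.
rewrite -!(mulmxA (diag_mx _)) KK mulmx1.
congr block_mx.
have -> : T *m M *m U *m T^T
    = x *: (diag_mx (\row_i (~~ odd i)%:R) *m (T *m U *m T^T))
      + y *: (T *m U *m T^T - diag_mx (\row_i (~~ odd i)%:R) *m (T *m U *m T^T))
      + a *: (T *m w ^+ 2 *m U *m T^T) + b *: (T *m w ^+ 1 *m U *m T^T).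
  rewrite /M !mulmxDr -!scalemxAr mulmxBr mulmx1 Te.
  by rewrite !mulmxDl -!scalemxAl !mulmxBl !mulmxA.
rewrite TUT !Tk !mul_diag_mx; apply/matrixP => i j; rewrite !mxE.
case: i => [[|[|[|//]]]] ?; case: j => [[|[|[|//]]]] ?; rewrite /=;
  by rewrite ?(mulr0, mul0r, mulr1, oppr0, addr0, add0r, subrr).
Qed.

Lemma embedding_normal_form (m : nat) (L : set 'M[F]_(3 + m)) :
  (m <= 2)%N -> is_embedding (E1 F) L ->
  exists d : 'I_m -> bool, forall s : 'S_m,
    congruent L [set M | exists v w x y, M = E1_space_mx (d \o s) v w x y].
Proof.
move=> m2 [U [phi [[symU unitU] [symphi injphi] mulphi phi1 ->]]].
have [tr ww] := embedding_triple symU unitU symphi injphi mulphi.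
have [d norm] := triple_normal_form m2 tr.
exists d => s; have [P unitP PE] := norm s; exists P => //.
pose comb v w x y : 'M[F]_(3 + m) :=
  x *: phi (E1_X F) + y *: phi (E1_Y F) + v *: phi (E1_V F) + w *: phi (E1_W F).
have phiXY : phi (E1_X F) + phi (E1_Y F) = U by rewrite -phi1 -linearD.
have combE v w x y : P *m comb v w x y *m P^T = E1_space_mx (d \o s) v w x y.
  rewrite -PE ww !mulmxDl -!scalemxAl mulmxBl mul1mx !mulmxKV //.
  by rewrite -[in U - _]phiXY (addrC (phi (E1_X F))) addrK.
have phiE a : phi a = comb (a 0 2%:R) (a 0 3%:R) (a 0 0) (a 0 1).
  by rewrite {1}(E1_decomp a) !linearD /= !linearZ.
apply/seteqP; split=> [M [v [w [x [y ->]]]]|M /= [_ [a _ <-] <-]]; last first.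
  rewrite phiE combE.
  by exists (a 0 2%:R), (a 0 3%:R), (a 0 0), (a 0 1).
rewrite -combE; exists (comb v w x y) => //.
exists (x *: E1_X F + y *: E1_Y F + v *: E1_V F + w *: E1_W F) => //.
by rewrite !linearD /= !linearZ.
Qed.

Lemma E1_space_mx_rows (m : nat) (d : 'I_m -> bool) rows :
  (forall v w x y, E1_space_mx d v w x y = mx_of_rows (3 + m) (rows v w x y)) ->
  [set M | exists v w x y, M = E1_space_mx d v w x y] = mx_space (3 + m) rows.
Proof.
move=> rE; apply/seteqP; split=> M [v [w [x [y ->]]]]; exists v, w, x, y;
  by rewrite rE.
Qed.

End NormalForm.

Ltac by_entries :=
  apply: E1_space_mx_rows => v w x y;
  rewrite -[RHS]submxK; congr block_mx; apply/matrixP;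
  do 2 (case=> [[|[|[|//]]] //= ?]); rewrite !mxE //=.

Lemma mx_space4_E1 (F : numClosedFieldType) (b : bool) :
  [set M : 'M[F]_4 | exists v w x y,
     M = E1_space_mx (fun _ : 'I_1 => b) v w x y] =
  mx_space 4 (fun v w x y =>
    [:: [:: v; w; x; 0];
        [:: w; y; 0; 0];
        [:: x; 0; 0; 0];
        [:: 0; 0; 0; if b then x else y]]).
Proof. by by_entries. Qed.

Lemma mx_space5_E1 (F : numClosedFieldType) (b c : bool) :
  [set M : 'M[F]_5 | exists v w x y,
     M = E1_space_mx (fun i : 'I_2 => if i == 0 then b else c) v w x y] =
  mx_space 5 (fun v w x y =>
    [:: [:: v; w; x; 0; 0];
        [:: w; y; 0; 0; 0];
        [:: x; 0; 0; 0; 0];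
        [:: 0; 0; 0; if b then x else y; 0];
        [:: 0; 0; 0; 0; if c then x else y]]).
Proof. by by_entries. Qed.

Theorem propositionA24 (R : realType) :
  (forall L : set 'M[R[i]]_4,
    is_embedding (E1 R[i]) L ->
    congruent L (mx_space 4 (fun v w x y : R[i] =>
                 [:: [:: v; w; x; 0];
                     [:: w; y; 0; 0];
                     [:: x; 0; 0; 0];
                     [:: 0; 0; 0; x]])) \/
    congruent L (mx_space 4 (fun v w x y : R[i] =>
                 [:: [:: v; w; x; 0];
                     [:: w; y; 0; 0];
                     [:: x; 0; 0; 0];
                     [:: 0; 0; 0; y]]))) /\
  (forall L : set 'M[R[i]]_5,
    is_embedding (E1 R[i]) L ->
    [\/ congruent L (mx_space 5 (fun v w x y : R[i] =>
                 [:: [:: v; w; x; 0; 0];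
                     [:: w; y; 0; 0; 0];
                     [:: x; 0; 0; 0; 0];
                     [:: 0; 0; 0; x; 0];
                     [:: 0; 0; 0; 0; x]])),
        congruent L (mx_space 5 (fun v w x y : R[i] =>
                 [:: [:: v; w; x; 0; 0];
                     [:: w; y; 0; 0; 0];
                     [:: x; 0; 0; 0; 0];
                     [:: 0; 0; 0; x; 0];
                     [:: 0; 0; 0; 0; y]]))
      | congruent L (mx_space 5 (fun v w x y : R[i] =>
                 [:: [:: v; w; x; 0; 0];
                     [:: w; y; 0; 0; 0];
                     [:: x; 0; 0; 0; 0];
                     [:: 0; 0; 0; y; 0];
                     [:: 0; 0; 0; 0; y]]))]).
Proof.
split=> L emb.
  have [d /(_ 1%g)] := @embedding_normal_form _ 1 L isT emb.
  have -> : d \o (1%g : 'S_1) = fun=> d 0.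
    by apply/funext => i; rewrite /= perm1 ord1.
  by rewrite mx_space4_E1; case: (d 0); [left | right].
have [d congL] := @embedding_normal_form _ 2 L isT emb.
have pairE (s : 'S_2) : d \o s = fun i => if i == 0 then d (s 0) else d (s 1).
  by apply/funext; case=> [[|[|//]]] lti /=; congr (d (s _)); apply: val_inj.
(* The eigenvalues (0, 1) are reordered into (1, 0). *)
have := congL (tperm 0 1); have := congL 1%g.
rewrite !pairE !mx_space5_E1 !perm1 tpermL tpermR.
case: (d 0) (d 1) => -[];
  by [constructor 1 | constructor 2 | constructor 2 | constructor 3].
Qed.
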